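(* Let $G$ be a finite group with identity $e$, let $R[G]$ be its group algebra over $\mathbb{R}$, and let $$S=\{x=\textstyle\sum_{g\in G}x_g g\in R[G]:\ \sum_{g\in G}x_g=1,\ x_g\ge 0\ \text{for all } g\in G\}.$$ Let $p(t)=\sum_{k=0}^{\infty}a_kt^k$ be a power series with $0\le a_k<1$ for all $k\ge 0$ and $\sum_{k=0}^\infty a_k=1$, and consider the map $p:S\to S$, $p(x)=a_0e+\sum_{k\ge1}a_kx^k$. Then $p$ is ergodic on $S$: for every $x\in S$ the limit $$\lim_{n\to\infty}\frac1n\sum_{i=1}^n p^{[i]}(x)$$ exists, where $p^{[1]}(x)=p(x)$ and $p^{[i+1]}(x)=p(p^{[i]}(x))$.
   Context: $R[G]$ is considered with the Euclidean topology of the finite-dimensional real vector space with basis $G$. For $x\in S$ the series $a_0e+\sum_{k\ge1}a_kx^k$ converges and its value lies in $S$. *)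

(* Defs.v *)
From HB Require Import structures.
From mathcomp Require Import all_boot all_order all_algebra all_fingroup.
From mathcomp Require Import all_classical all_reals all_analysis.
Set Implicit Arguments. Unset Strict Implicit. Unset Printing Implicit Defensive.
Import Order.TTheory GRing.Theory Num.Theory.
Import numFieldTopology.Exports numFieldNormedType.Exports.
Local Open Scope ring_scope.

(* The group algebra R[G] of a finite group G (= all elements of gT),
   represented by coefficient functions x : gT -> R, x = \sum_g x g * g. *)

Definition galg_mul (R : realType) (gT : finGroupType) (x y : gT -> R) : gT -> R :=
  fun g => \sum_(h : gT) x h * y ((h^-1) * g)%g.

Definition galg_one (R : realType) (gT : finGroupType) : gT -> R :=
  fun g => if g == 1%g then 1 else 0.

Fixpoint galg_exp (R : realType) (gT : finGroupType) (x : gT -> R) (k : nat)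
  : gT -> R :=
  match k with
  | O => @galg_one R gT
  | S k' => @galg_mul R gT x (galg_exp x k')
  end.

Definition simplexS (R : realType) (gT : finGroupType) (x : gT -> R) : Prop :=
  (\sum_(g : gT) x g = 1) /\ (forall g, 0 <= x g).

Definition pmap (R : realType) (gT : finGroupType) (a : nat -> R) (x : gT -> R)
  : gT -> R :=
  fun g => limn (series (fun k => a k * galg_exp x k g)).

Definition piter (R : realType) (gT : finGroupType) (a : nat -> R) (i : nat)
  (x : gT -> R) : gT -> R := iter i (pmap a) x.

(* Main.v *)
Require Import Defs.
From HB Require Import structures.
From mathcomp Require Import all_boot all_order all_algebra all_fingroup.
From mathcomp Require Import all_classical all_reals all_analysis.
From mathcomp Require Import ring lra.
Import Order.TTheory GRing.Theory Num.Theory.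
Import numFieldTopology.Exports numFieldNormedType.Exports.
Set Implicit Arguments. Unset Strict Implicit. Unset Printing Implicit Defensive.
Local Open Scope classical_set_scope.
Local Open Scope ring_scope.

(* By nonnegativity, the supports of the iterates y_i = p^[i](x) multiply like
   subsets of G.  The subgroups K_i generated by (supp y_i)^|G| increase, since
   supp y_(i+1) contains (supp y_i)^k as soon as a_k > 0, so they are eventually
   equal to some K.  Let U be the uniform distribution on K and split
   y_i = U y_i + (1 - U) y_i for large i.
   - supp y_i lies in a coset K h_i, where h_(i+1) = h_i^k, and U y_i is the
     uniform distribution on K h_i: this part is eventually periodic.
   - (1 - U) y_i converges to q (1 - U), where q = lim p^[i](0): some power of
     y_J dominates a multiple of U, hence y_J acts on the range of 1 - U as a
     contraction of ratio r < 1 for a suitable seminorm.  As the iterates of p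
     have nonnegative coefficients, y_(J+i) - p^[i](0) then acts with norm at
     most p^[i](r) - p^[i](0), and this tends to 0 by convexity of p. *)

(** * Averages of bounded sequences under a probability law on exponents *)

Definition pmf (R : realType) (a : nat -> R) : Prop :=
  (forall k, 0 <= a k) /\ series a @ \oo --> (1 : R).

Definition bnd (R : realType) (f : nat -> R) : Prop :=
  exists C, forall k, `|f k| <= C.

(** The mean of [f] at a random exponent of law [a]; for a [pmf] and bounded [f] the series
    converges absolutely. *)
Definition expect (R : realType) (a f : nat -> R) : R :=
  limn (series (fun k => a k * f k)).

Lemma bnd_cst (R : realType) (c : R) : bnd (fun=> c).
Proof. by exists `|c|. Qed.

Lemma bndD (R : realType) (f h : nat -> R) :
  bnd f -> bnd h -> bnd (fun k => f k + h k).
Proof.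
move=> [C fC] [D hD]; exists (C + D) => k.
by apply: le_trans (ler_normD _ _) _; apply: lerD.
Qed.

Lemma bndM (R : realType) (f h : nat -> R) :
  bnd f -> bnd h -> bnd (fun k => f k * h k).
Proof.
move=> [C fC] [D hD]; exists (C * D) => k.
by rewrite normrM ler_pM.
Qed.

Lemma bndN (R : realType) (f : nat -> R) : bnd f -> bnd (fun k => - f k).
Proof. by move=> [C fC]; exists C => k; rewrite normrN. Qed.

Lemma bnd_norm (R : realType) (f : nat -> R) : bnd f -> bnd (fun k => `|f k|).
Proof. by move=> [C fC]; exists C => k; rewrite normr_id. Qed.

Lemma bnd_sum (R : realType) (I : finType) (f : I -> nat -> R) :
  (forall i, bnd (f i)) -> bnd (fun k => \sum_i f i k).
Proof.
move=> /choice[C fC]; exists (\sum_i C i) => k.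
by apply: le_trans (ler_norm_sum _ _ _) _; apply: ler_sum.
Qed.

Lemma bnd_exp (R : realType) (t : R) : 0 <= t <= 1 -> bnd (fun k => t ^+ k).
Proof.
move=> /andP[t0 t1]; exists 1 => k.
by rewrite ger0_norm ?exprn_ge0// exprn_ile1.
Qed.

Lemma is_cvg_expect (R : realType) (a f : nat -> R) : pmf a -> bnd f ->
  cvgn (series (fun k => a k * f k)).
Proof.
move=> [a0 a1] [C fC]; apply: normed_cvg.
have CS : cvgn (series (C *: a)) by apply: is_cvg_seriesZ; apply/cvg_ex; exists 1.
apply: (series_le_cvg _ _ _ CS) => k.
- exact: normr_ge0.
- by rewrite mulr_ge0//; exact: le_trans (fC k).
- by rewrite /= normrM ger0_norm// mulrC ler_wpM2r.
Qed.

Section expectation.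
Context (R : realType) (a : nat -> R) (ha : pmf a).
Implicit Types f h : nat -> R.

Lemma expect_cst c : expect a (fun=> c) = c.
Proof.
have [_ a1] := ha.
rewrite /expect (_ : (fun k => a k * c) = c *: (a : R ^nat)); last first.
  by apply/funext => k; rewrite mulrC.
rewrite lim_seriesZ; last by apply/cvg_ex; exists 1.
by rewrite (cvg_lim _ a1)// [LHS]mulr1.
Qed.

Lemma expectD f h : bnd f -> bnd h ->
  expect a (fun k => f k + h k) = expect a f + expect a h.
Proof.
move=> bf bh; rewrite /expect -lim_seriesD; [|exact: is_cvg_expect..].
by congr (limn (series _)); apply/funext => k; rewrite mulrDr.
Qed.

Lemma expectZ c f : bnd f -> expect a (fun k => c * f k) = c * expect a f.
Proof.
move=> bf; rewrite /expect -[RHS]lim_seriesZ; last exact: is_cvg_expect.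
by congr (limn (series _)); apply/funext => k; rewrite mulrCA.
Qed.

Lemma expectB f h : bnd f -> bnd h ->
  expect a (fun k => f k - h k) = expect a f - expect a h.
Proof.
move=> bf bh; rewrite expectD//; last exact: bndN.
congr (_ + _); rewrite -mulN1r -expectZ//.
by congr expect; apply/funext => k; rewrite mulN1r.
Qed.

Lemma ler_expect f h : bnd f -> bnd h -> (forall k, f k <= h k) ->
  expect a f <= expect a h.
Proof.
move=> bf bh fh; apply: lim_series_le; [exact: is_cvg_expect..|] => k.
by rewrite ler_wpM2l//; apply: ha.1.
Qed.

Lemma expect_sum (I : finType) (f : I -> nat -> R) : (forall i, bnd (f i)) ->
  expect a (fun k => \sum_i f i k) = \sum_i expect a (f i).
Proof.
move=> bf; rewrite -big_enum /=.
under [in LHS]eq_fun do rewrite -big_enum /=.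
elim: (enum I) => [|i s IH].
  under eq_fun do rewrite big_nil.
  by rewrite expect_cst big_nil.
under eq_fun do rewrite big_cons.
rewrite big_cons expectD ?IH// => {IH}.
elim: s => [|j s IH]; first by under eq_fun do rewrite big_nil; exact: bnd_cst.
by under eq_fun do rewrite big_cons; apply: bndD.
Qed.

Lemma ler_norm_expect f : bnd f -> `|expect a f| <= expect a (fun k => `|f k|).
Proof.
move=> bf; rewrite ler_norml; apply/andP; split.
  rewrite -mulN1r -expectZ; last exact: bnd_norm.
  apply: ler_expect => // [|k]; last by rewrite mulN1r lerNl ler_normr lexx orbT.
  by apply: bndM; [exact: bnd_cst|exact: bnd_norm].
by apply: ler_expect => // [|k]; [exact: bnd_norm|exact: ler_norm].
Qed.

Lemma expect_ge_term f k : bnd f -> (forall j, 0 <= f j) ->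
  a k * f k <= expect a f.
Proof.
move=> bf f0; have c := is_cvg_expect ha bf.
apply: le_trans (nondecreasing_cvgn_le _ c k.+1); last first.
  by apply: nondecreasing_series => i _ _; rewrite mulr_ge0//; apply: ha.1.
by rewrite /series/= big_nat_recr//= lerDr sumr_ge0// => i _; rewrite mulr_ge0//; apply: ha.1.
Qed.

End expectation.

Lemma expect_delta (R : realType) (a : nat -> R) (j : nat) :
  expect a (fun k => (k == j)%:R) = a j.
Proof.
rewrite /expect; apply: lim_near_cst => //; exists j.+1 => // n /= jn.
rewrite /series/= (bigD1_seq j) ?mem_index_iota ?iota_uniq//= eqxx mulr1.
by rewrite big1 ?addr0// => k /negbTE ->; rewrite mulr0.
Qed.

(** * The generating function on the unit interval and its iterates *)

Definition genfun (R : realType) (a : nat -> R) (t : R) : R :=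
  expect a (fun k => t ^+ k).

(** Quantitative convexity along the chord from [s] to 1. The gap is the same for all [k >= 2], so
    it survives averaging over [k]. *)
Lemma chord_exp_gap (R : realType) (s v : R) (k : nat) : 0 <= s <= 1 -> 0 <= v <= 1 ->
  ((1 - v) * s + v) ^+ k
    <= (1 - v) * s ^+ k + v - v * (1 - v) * (1 - s) ^+ 2 * (2 <= k)%:R.
Proof.
move=> /andP[s0 s1] /andP[v0 v1].
have w0 : 0 <= (1 - v) * s + v by nra.
have v'0 : 0 <= v * (1 - v) by nra.
have c0 : 0 <= v * (1 - v) * (1 - s) ^+ 2 by rewrite mulr_ge0 ?sqr_ge0.
elim: k => [|[_|k IH]]; first by rewrite !expr0 /= mulr0; lra.
  by rewrite !expr1 /= mulr0; lra.
rewrite exprS; apply: le_trans (ler_wpM2l w0 IH) _ => {IH}.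
set S := s ^+ k.+1; have S01 : 0 <= S <= s.
  by rewrite /S exprn_ge0//= exprS ler_piMr// exprn_ile1.
rewrite [s ^+ k.+2]exprS -/S /= mulr1.
set b := (_ <= _)%:R; have b0 : 0 <= b :> R by rewrite ler0n.
have := mulr_ge0 w0 (mulr_ge0 c0 b0); set T := _ * (_ * b) => T0.
(* The inherited gap [T] is dropped later: the product of the two chords creates a new gap, large
   enough because [S <= s]. *)
have -> : ((1 - v) * s + v) * ((1 - v) * S + v - v * (1 - v) * (1 - s) ^+ 2 * b)
  = (1 - v) * (s * S) + v - v * (1 - v) * ((1 - s) * (1 - S)) - T.
  by rewrite /T; ring.
have : (1 - s) ^+ 2 <= (1 - s) * (1 - S) by rewrite expr2 ler_wpM2l; lra.
move=> /(ler_wpM2l v'0); lra.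
Qed.

Section genfun.
Context (R : realType) (a : nat -> R) (ha : pmf a).

Lemma ler_genfun (s t : R) : 0 <= s -> s <= t -> t <= 1 ->
  genfun a s <= genfun a t.
Proof.
move=> s0 st t1; apply: ler_expect => //; [apply: bnd_exp; lra..|] => k.
by rewrite lerXn2r// nnegrE (le_trans s0).
Qed.

Lemma genfun_itv (t : R) : 0 <= t <= 1 -> 0 <= genfun a t <= 1.
Proof.
move=> t01; have /andP[t0 t1] := t01; apply/andP; split.
  rewrite -(expect_cst ha 0); apply: ler_expect => // [||k]; last exact: exprn_ge0.
    exact: bnd_cst.
  exact: bnd_exp.
rewrite -(expect_cst ha 1); apply: ler_expect => // [||k].
- exact: bnd_exp.
- exact: bnd_cst.
- exact: exprn_ile1.
Qed.

(** The mass on exponents at least 2, hence the weight of the convexity gap in [genfun a]. *)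
Let m := expect a (fun k => (2 <= k)%:R).

Let bnd2 : bnd (fun k => (2 <= k)%:R : R).
Proof. by exists 1 => k; rewrite ger0_norm// lern1 leq_b1. Qed.

Let m01 : 0 <= m <= 1.
Proof.
rewrite -(expect_cst ha 0) -(expect_cst ha 1).
apply/andP; split; (apply: ler_expect => //; first exact: bnd_cst) => k.
by rewrite lern1 leq_b1.
Qed.

Lemma genfun_chord (s v : R) : 0 <= s <= 1 -> 0 <= v <= 1 ->
  genfun a ((1 - v) * s + v)
    <= (1 - v) * genfun a s + v - v * (1 - v) * (1 - s) ^+ 2 * m.
Proof.
move=> s01 v01; have bs := bnd_exp s01.
have bl : bnd (fun k => (1 - v) * s ^+ k) by apply: bndM => //; exact: bnd_cst.
have bl2 : bnd (fun k => (1 - v) * s ^+ k + v) by apply: bndD => //; exact: bnd_cst.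
have br : bnd (fun k => v * (1 - v) * (1 - s) ^+ 2 * (2 <= k)%:R).
  by apply: bndM => //; exact: bnd_cst.
rewrite /genfun -expectZ// -[X in _ + X - _](expect_cst ha) -expectD//; last exact: bnd_cst.
rewrite /m -expectZ// -expectB//; apply: ler_expect => // [||k].
- by apply: bnd_exp; move/andP: s01 => [? ?]; move/andP: v01 => [? ?]; nra.
- by apply: bndD => //; exact: bndN.
- exact: chord_exp_gap.
Qed.

(** Term by term, [1 - s ^+ k] is 0 for [k = 0], [1 - s] for [k = 1], and at most 1 from [k = 2]
    on. *)
Lemma one_sub_genfun_le (s : R) : 0 <= s <= 1 ->
  1 - genfun a s <= (1 - s) * a 1%N + m.
Proof.
move=> s01; have bs := bnd_exp s01; have /andP[s0 s1] := s01.
have b1 : bnd (fun k => (k == 1)%:R : R).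
  by exists 1 => k; rewrite ger0_norm// lern1 leq_b1.
have b1' : bnd (fun k => (1 - s) * (k == 1)%:R).
  by apply: bndM => //; exact: bnd_cst.
rewrite -{1}(expect_cst ha 1) /genfun -expectB//; last exact: bnd_cst.
rewrite -(expect_delta a 1) -expectZ// /m -expectD//; apply: ler_expect => //.
- by apply: bndD; [exact: bnd_cst|exact: bndN].
- exact: bndD.
- move=> [|[|k]]; rewrite ?expr0 ?expr1 /= ?(mulr1, mulr0, addr0, subrr, add0r)//.
  by rewrite gerBl exprn_ge0.
Qed.

Lemma genfun_iter_itv (t : R) i : 0 <= t <= 1 -> 0 <= iter i (genfun a) t <= 1.
Proof. by move=> t01; elim: i => //= i; exact: genfun_itv. Qed.

Lemma genfun_iter_le (s t : R) i : 0 <= s -> s <= t -> t <= 1 ->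
  iter i (genfun a) s <= iter i (genfun a) t.
Proof.
move=> s0 st t1; have s01 : 0 <= s <= 1 by lra.
have t01 : 0 <= t <= 1 by lra.
elim: i => //= i IH; have /andP[? _] := genfun_iter_itv i s01.
by have /andP[_ ?] := genfun_iter_itv i t01; exact: ler_genfun.
Qed.

(** The orbit of 0 increases since [genfun a] is monotone and [0 <= genfun a 0]. Its limit is the
    extinction probability of the branching process with offspring law [a]. *)
Lemma genfun_iter0_cvg : exists2 q : R, forall i, iter i (genfun a) 0 <= q &
  iter i (genfun a) 0 @[i --> \oo] --> q /\ q <= 1.
Proof.
have s01 i : 0 <= iter i (genfun a) 0 <= 1 by apply: genfun_iter_itv; lra.
have nd : nondecreasing_seq (fun i => iter i (genfun a) 0).
  apply/nondecreasing_seqP => i; rewrite iterSr; apply: genfun_iter_le => //.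
    by have /andP[] := s01 1%N.
  by have /andP[] := s01 1%N.
have c : cvgn (fun i => iter i (genfun a) 0).
  by apply: nondecreasing_is_cvgn => //; exists 1 => _ [i _ <-]; have /andP[] := s01 i.
exists (limn (fun i => iter i (genfun a) 0)) => [i|]; first exact: nondecreasing_cvgn_le.
split=> //; apply: limr_le => //; near=> i; by have /andP[] := s01 i.
Unshelve. all: by end_near. Qed.

(* With [s <= t = (1 - v) s + v], convexity makes the relative position
   [v = (t - s) / (1 - s)] contract under [genfun a], uniformly as long as
   [s] stays away from 1. *)
Lemma genfun_iter_coalesce (r : R) : a 1%N < 1 -> 0 <= r < 1 ->
  iter i (genfun a) r - iter i (genfun a) 0 @[i --> \oo] --> (0 : R).
Proof.
move=> a1 /andP[r0 r1]; have [q sq [sq_cvg q1]] := genfun_iter0_cvg.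
have s01 i : 0 <= iter i (genfun a) 0 <= 1 by apply: genfun_iter_itv; lra.
have t01 i : 0 <= iter i (genfun a) r <= 1 by apply: genfun_iter_itv; lra.
have st i : iter i (genfun a) 0 <= iter i (genfun a) r.
  by apply: genfun_iter_le => //; exact: ltW.
have q0 : 0 <= q by have := sq 0%N.
(* If [q = 1], the orbit of [r] is squeezed between the orbit of 0 and 1. *)
have [q1'|q1'] := eqVneq q 1.
  apply: (@squeeze_cvgr _ _ _ _ (fun=> 0) (fun i => 1 - iter i (genfun a) 0)).
  - near=> i; rewrite subr_ge0 st/= lerB//; by have /andP[] := t01 i.
  - exact: cvg_cst.
  - by rewrite -[X in _ --> X](subrr q) {1}q1'; apply: cvgB => //; exact: cvg_cst.
have {}q1 : q < 1 by rewrite lt_neqAle q1'.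
(* If [m = 0], then [one_sub_genfun_le] becomes [1 - q <= (1 - q) * a 1] in the limit, against
   [a 1 < 1]. *)
have m0 : 0 < m.
  rewrite lt_neqAle (andP m01).1 andbT eq_sym; apply/eqP => m0.
  suff : 1 - q <= (1 - q) * a 1%N by nra.
  have h1 : 1 - iter i.+1 (genfun a) 0 @[i --> \oo] --> 1 - q.
    apply: cvgB; first exact: cvg_cst.
    by rewrite -(cvg_shiftn 1) in sq_cvg; under eq_fun do rewrite -addn1.
  have h2 : (1 - iter i (genfun a) 0) * a 1%N @[i --> \oo] --> (1 - q) * a 1%N.
    by apply: cvgM; [apply: cvgB => //; exact: cvg_cst|exact: cvg_cst].
  apply: (ler_cvg_to h1 h2); near=> i.
  by apply: le_trans (one_sub_genfun_le (s01 i)) _; rewrite m0 addr0.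
(* The gap divided by [v] is [(1 - v) * (1 - s) ^+ 2 * m], which is at least [1 - kap] when [v <= r]
   and [s <= q]. *)
pose kap := 1 - m * (1 - r) * (1 - q) ^+ 2.
have /andP[_ m1] := m01.
have kap01 : 0 <= kap < 1.
  rewrite subr_ge0 gtrBl; apply/andP; split; last first.
    by rewrite !mulr_gt0 ?exprn_gt0// subr_gt0.
  by apply: mulr_ile1; [nra|exact: sqr_ge0|nra|rewrite exprn_ile1//; lra].
have key i : iter i (genfun a) r <=
    (1 - kap ^+ i * r) * iter i (genfun a) 0 + kap ^+ i * r.
  elim: i => [|i IH]; first by rewrite expr0 /=; lra.
  set v := kap ^+ i * r in IH.
  have v01 : 0 <= v <= r.
    have : 0 <= kap ^+ i <= 1 by rewrite exprn_ge0 ?exprn_ile1//; lra.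
    by rewrite /v => /andP[? ?]; nra.
  have v01' : 0 <= v <= 1 by lra.
  rewrite exprS -mulrA -/v [iter _ _ r]/= [iter _ _ 0]/=.
  set s := iter i _ 0 in IH *.
  have /andP[v0 vr] := v01; have /andP[s0 s1] : 0 <= s <= 1 by exact: s01.
  have gt : genfun a (iter i (genfun a) r) <= genfun a ((1 - v) * s + v).
    by apply: ler_genfun => //; [have /andP[]:= t01 i|nra].
  apply: (le_trans gt); apply: le_trans (genfun_chord (s01 i) v01') _.
  rewrite -/s; have /andP[g0 g1] := genfun_itv (s01 i); rewrite -/s in g0 g1.
  set g := genfun a s in g0 g1 *.
  (* This is what remains when the chord at [v], lowered by its gap, is compared with the chord at
     [kap * v]. *)
  suff : (1 - kap) * v * (1 - g) <= v * (1 - v) * (1 - s) ^+ 2 * m by lra.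
  apply: (@le_trans _ _ ((1 - kap) * v)).
    by rewrite ler_piMr//; [rewrite mulr_ge0//; lra|lra].
  have -> : (1 - kap) * v = (v * m) * ((1 - r) * (1 - q) ^+ 2) by rewrite /kap; ring.
  have -> : v * (1 - v) * (1 - s) ^+ 2 * m = (v * m) * ((1 - v) * (1 - s) ^+ 2) by ring.
  apply: ler_wpM2l; first by rewrite mulr_ge0// ltW.
  apply: ler_pM; [lra|exact: sqr_ge0|lra|].
  by have := sq i; rewrite -/s => ?; rewrite lerXn2r ?nnegrE; lra.
apply: (@squeeze_cvgr _ _ _ _ (fun=> 0) (fun i => r * kap ^+ i)).
- near=> i; rewrite subr_ge0 st/=; have := key i.
  have /andP[? ?] := s01 i; have : 0 <= kap ^+ i * r.
    by rewrite mulr_ge0// exprn_ge0//; lra.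
  rewrite [r * _]mulrC; set v := kap ^+ i * r => v0 tv.
  have : 0 <= v * iter i (genfun a) 0 by rewrite mulr_ge0.
  lra.
- exact: cvg_cst.
- by apply: cvg_geometric; rewrite ger0_norm; lra.
Unshelve. all: by end_near. Qed.

End genfun.

(** * The group algebra as a ring, its [l1] norm and the simplex *)

(* An alias of [gT -> R] on which the product is convolution: the instances on
   function types would multiply pointwise. *)
Definition galg (R : realType) (gT : finGroupType) : Type := gT -> R.

HB.instance Definition _ (R : realType) (gT : finGroupType) :=
  GRing.Lmodule.copy (galg R gT) (gT -> R^o).

Section galg_ring.
Context (R : realType) (gT : finGroupType).
Implicit Types x y z : galg R gT.

Lemma galg_mulE x y g : galg_mul x y g = \sum_h x (g * h^-1)%g * y h.
Proof.
rewrite /galg_mul (reindex_inj invg_inj) (reindex_inj (mulIg g^-1%g)) /=.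
by apply: eq_bigr => h _; rewrite invgK invMg invgK mulgVK.
Qed.

Lemma galg_mulA : associative (@galg_mul R gT).
Proof.
move=> x y z; apply/funext => g; rewrite [RHS]galg_mulE.
under [RHS]eq_bigr do rewrite mulr_suml.
rewrite exchange_big /=; apply: eq_bigr => h _.
rewrite galg_mulE mulr_sumr; apply: eq_bigr => j _.
by rewrite mulrA mulgA.
Qed.

Lemma galg_mul1l : left_id (@galg_one R gT) (@galg_mul R gT).
Proof.
move=> x; apply/funext => g; rewrite /galg_mul (bigD1 1%g)//= /galg_one eqxx.
by rewrite mul1r invg1 mul1g big1 ?addr0// => h /negbTE ->; rewrite mul0r.
Qed.

Lemma galg_mul1r : right_id (@galg_one R gT) (@galg_mul R gT).
Proof.
move=> x; apply/funext => g; rewrite galg_mulE (bigD1 1%g)//= /galg_one eqxx.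
by rewrite mulr1 invg1 mulg1 big1 ?addr0// => h /negbTE ->; rewrite mulr0.
Qed.

Lemma galg_mulDl : left_distributive (@galg_mul R gT) (@GRing.add (galg R gT)).
Proof.
move=> x y z; apply/funext => g.
transitivity (\sum_h (x h * z (h^-1 * g)%g + y h * z (h^-1 * g)%g)).
  by apply: eq_bigr => h _; rewrite -mulrDl.
by rewrite big_split.
Qed.

Lemma galg_mulDr : right_distributive (@galg_mul R gT) (@GRing.add (galg R gT)).
Proof.
move=> x y z; apply/funext => g.
transitivity (\sum_h (x h * y (h^-1 * g)%g + x h * z (h^-1 * g)%g)).
  by apply: eq_bigr => h _; rewrite -mulrDr.
by rewrite big_split.
Qed.

HB.instance Definition _ := GRing.Zmodule_isPzRing.Build (galg R gT)
  galg_mulA galg_mul1l galg_mul1r galg_mulDl galg_mulDr.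

Lemma galg_oner_neq0 : (1 : galg R gT) != 0.
Proof.
apply/eqP => /(congr1 (fun x : galg R gT => x 1%g)).
rewrite [X in X = _]/(galg_one _ _) /galg_one eqxx => /eqP.
by rewrite [X in _ == X]/(0 : R) oner_eq0.
Qed.

HB.instance Definition _ := GRing.PzSemiRing_isNonZero.Build (galg R gT)
  galg_oner_neq0.

Lemma galg_scalerAl (c : R) x y : c *: (x * y) = (c *: x) * y.
Proof.
apply/funext => g; transitivity (c * \sum_h x h * y (h^-1 * g)%g) => //; rewrite mulr_sumr.
by apply: eq_bigr => h _; rewrite mulrA.
Qed.

HB.instance Definition _ := GRing.Lmodule_isLalgebra.Build R (galg R gT)
  galg_scalerAl.

Lemma galg_scalerAr (c : R) x y : c *: (x * y) = x * (c *: y).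
Proof.
apply/funext => g; transitivity (c * \sum_h x h * y (h^-1 * g)%g) => //; rewrite mulr_sumr.
by apply: eq_bigr => h _; rewrite mulrCA.
Qed.

HB.instance Definition _ := GRing.Lalgebra_isAlgebra.Build R (galg R gT)
  galg_scalerAr.

Lemma galgDE x y g : (x + y) g = x g + y g. Proof. by []. Qed.
Lemma galgNE x g : (- x) g = - x g. Proof. by []. Qed.
Lemma galgZE (c : R) x g : (c *: x) g = c * x g. Proof. by []. Qed.
Lemma galg1E g : (1 : galg R gT) g = (g == 1%g)%:R.
Proof. by rewrite [LHS]/(galg_one _ _) /galg_one; case: eqP. Qed.
Lemma galgME x y g : (x * y) g = \sum_h x h * y (h^-1 * g)%g. Proof. by []. Qed.
Lemma galg_expE x k : galg_exp x k = x ^+ k.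
Proof. by elim: k => //= k ->; rewrite exprS. Qed.

(** The augmentation homomorphism of the group algebra. *)
Definition aug x : R := \sum_g x g.
Definition l1 x : R := \sum_g `|x g|.

Lemma aug_galgM x y : aug (x * y) = aug x * aug y.
Proof.
rewrite /aug mulr_suml exchange_big /=; apply: eq_bigr => h _.
by rewrite mulr_sumr (reindex_inj (mulgI h)) /=; apply: eq_bigr => g _; rewrite mulKg.
Qed.

Lemma l1_ge0 x : 0 <= l1 x. Proof. exact: sumr_ge0. Qed.

Lemma l1D x y : l1 (x + y) <= l1 x + l1 y.
Proof. by rewrite /l1 -big_split; apply: ler_sum => g _; exact: ler_normD. Qed.

Lemma l1Z c x : l1 (c *: x) = `|c| * l1 x.
Proof. by rewrite /l1 mulr_sumr; apply: eq_bigr => g _; rewrite normrM. Qed.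

(** Replacing coefficients by their absolute values turns [l1] into the multiplicative [aug]; the
    triangle inequality does the rest. *)
Lemma l1M x y : l1 (x * y) <= l1 x * l1 y.
Proof.
pose nx : galg R gT := fun g => `|x g|; pose ny : galg R gT := fun g => `|y g|.
rewrite [leRHS](_ : _ = aug (nx * ny)); last by rewrite aug_galgM.
apply: ler_sum => g _; apply: le_trans (ler_norm_sum _ _ _) _.
by apply: ler_sum => h _; rewrite normrM.
Qed.

Lemma ler_norm_l1 x g : `|x g| <= l1 x.
Proof. by rewrite /l1 (bigD1 g)//= lerDl sumr_ge0. Qed.

Lemma simplexS_l1 x : simplexS x -> l1 x = 1.
Proof. by move=> [x1 x0]; rewrite -x1; apply: eq_bigr => g _; rewrite ger0_norm. Qed.

Lemma simplexSM x y : simplexS x -> simplexS y -> simplexS (x * y).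
Proof.
move=> [x1 x0] [y1 y0]; split; first by rewrite -/(aug _) aug_galgM /aug x1 y1 mulr1.
by move=> g; apply: sumr_ge0 => h _; rewrite mulr_ge0.
Qed.

Lemma simplexS1 : simplexS (1 : galg R gT).
Proof.
split=> [|g]; last by rewrite galg1E ler0n.
by rewrite (bigD1 1%g)//= big1 ?galg1E ?eqxx ?addr0// => g /negbTE; rewrite galg1E => ->.
Qed.

Lemma simplexSX x k : simplexS x -> simplexS (x ^+ k).
Proof.
by move=> Sx; elim: k => [|k IH]; [exact: simplexS1|rewrite exprS; exact: simplexSM].
Qed.

Lemma simplexS_le1 x g : simplexS x -> 0 <= x g <= 1.
Proof. by move=> Sx; rewrite Sx.2 -(simplexS_l1 Sx) (le_trans _ (ler_norm_l1 _ g))// ler_norm. Qed.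

End galg_ring.

(** * Averages with values in the group algebra *)

Section galg_expect.
Context (R : realType) (gT : finGroupType) (a : nat -> R) (ha : pmf a).
Implicit Types (F : nat -> galg R gT) (v : galg R gT).

Definition gexpect F : galg R gT := fun g => expect a (fun k => F k g).

Definition gbnd F : Prop := bnd (fun k => l1 (F k)).

Lemma gbnd_coord F g : gbnd F -> bnd (fun k => F k g).
Proof.
move=> [C FC]; exists C => k; apply: le_trans (ler_norm_l1 _ g) _.
by apply: le_trans (FC k); exact: ler_norm.
Qed.

Lemma gbnd_le F (b : nat -> R) : bnd b -> (forall k, l1 (F k) <= b k) -> gbnd F.
Proof.
move=> [C bC] Fb; exists C => k; rewrite ger0_norm ?l1_ge0//.
by apply: le_trans (bC k); apply: le_trans (Fb k) _; exact: ler_norm.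
Qed.

Lemma gbndD F F' : gbnd F -> gbnd F' -> gbnd (fun k => F k + F' k).
Proof. by move=> bF bF'; apply: (gbnd_le (bndD bF bF')) => k; exact: l1D. Qed.

Lemma gbndZ (c : nat -> R) v : bnd c -> gbnd (fun k => c k *: v).
Proof.
move=> bc; apply: (@gbnd_le _ (fun k => `|c k| * l1 v)).
  by apply: bndM; [exact: bnd_norm|exact: bnd_cst].
by move=> k; rewrite l1Z.
Qed.

Lemma gbndMl v F : gbnd F -> gbnd (fun k => v * F k).
Proof.
move=> bF; apply: (@gbnd_le _ (fun k => l1 v * l1 (F k))).
  by apply: bndM => //; exact: bnd_cst.
by move=> k; exact: l1M.
Qed.

Lemma gbndMr v F : gbnd F -> gbnd (fun k => F k * v).
Proof.
move=> bF; apply: (@gbnd_le _ (fun k => l1 (F k) * l1 v)).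
  by apply: bndM => //; exact: bnd_cst.
by move=> k; exact: l1M.
Qed.

Lemma gexpectMl v F : gbnd F -> v * gexpect F = gexpect (fun k => v * F k).
Proof.
move=> bF; apply/funext => g; rewrite galgME /gexpect.
under [X in _ = expect _ X]eq_fun do rewrite galgME.
rewrite expect_sum//; last first.
  by move=> h; apply: bndM; [exact: bnd_cst|exact: gbnd_coord].
by apply: eq_bigr => h _; rewrite expectZ//; exact: gbnd_coord.
Qed.

Lemma gexpectMr v F : gbnd F -> gexpect F * v = gexpect (fun k => F k * v).
Proof.
move=> bF; apply/funext => g; rewrite galgME /gexpect.
under [X in _ = expect _ X]eq_fun do rewrite galgME.
rewrite expect_sum//; last first.
  by move=> h; apply: bndM; [exact: gbnd_coord|exact: bnd_cst].
apply: eq_bigr => h _; rewrite mulrC -expectZ//; last exact: gbnd_coord.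
by congr expect; apply/funext => k; rewrite mulrC.
Qed.

Lemma gexpectB F F' : gbnd F -> gbnd F' ->
  gexpect (fun k => F k - F' k) = gexpect F - gexpect F'.
Proof.
move=> bF bF'; apply/funext => g; rewrite /gexpect galgDE galgNE.
by rewrite -expectB//; exact: gbnd_coord.
Qed.

Lemma gexpectZ (c : nat -> R) v : bnd c ->
  gexpect (fun k => c k *: v) = expect a c *: v.
Proof.
move=> bc; apply/funext => g; rewrite /gexpect galgZE mulrC -expectZ//.
by congr expect; apply/funext => k; rewrite galgZE mulrC.
Qed.

Lemma l1_gexpect F : gbnd F -> l1 (gexpect F) <= expect a (fun k => l1 (F k)).
Proof.
move=> bF; rewrite /l1 expect_sum//; last first.
  by move=> g; apply: bnd_norm; exact: gbnd_coord.
by apply: ler_sum => g _; apply: ler_norm_expect => //; exact: gbnd_coord.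
Qed.

Lemma gbnd_exp (x : galg R gT) : simplexS x -> gbnd (fun k => x ^+ k).
Proof.
by move=> Sx; exists 1 => k; rewrite (simplexS_l1 (simplexSX k Sx)) normr1.
Qed.

(** Presents the map of the theorem as a mean of ring powers, to which the linearity of [gexpect]
    applies. *)
Lemma pmapE (x : galg R gT) : Defs.pmap a x = gexpect (fun k => x ^+ k).
Proof.
apply/funext => g; rewrite /Defs.pmap /gexpect /expect.
by under eq_fun do rewrite galg_expE.
Qed.

Lemma pmap_simplex (x : galg R gT) : simplexS x -> simplexS (Defs.pmap a x).
Proof.
move=> Sx; rewrite pmapE; split=> [|g]; last first.
  rewrite -(expect_cst ha 0); apply: ler_expect => // [||k].
  - exact: bnd_cst.
  - by apply: gbnd_coord; exact: gbnd_exp.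
  - by have /andP[] := simplexS_le1 g (simplexSX k Sx).
rewrite -expect_sum//; last by move=> g; apply: gbnd_coord; exact: gbnd_exp.
rewrite -[RHS](expect_cst ha); congr expect; apply/funext => k.
by have [] := simplexSX k Sx.
Qed.

Lemma piter_simplex (x : galg R gT) i : simplexS x -> simplexS (piter a i x).
Proof. by move=> Sx; elim: i => //= i; exact: pmap_simplex. Qed.

End galg_expect.

(** * Powers of subsets of a finite group *)

Section return_group.
Context (gT : finGroupType).
Implicit Types A B : {set gT}.
Local Open Scope group_scope.

(** Every element has trivial [#|gT|]-th power, so this power of a nonempty [A] contains 1. *)
Definition return_group A : {group gT} := <<A ^+ #|gT| >>%G.

Lemma expg_cardT (h : gT) : h ^+ #|gT| = 1.
Proof.
have /dvdnP[k ->] : (#[h] %| #|gT|)%N by rewrite -cardsT cardSg ?finset.subsetT.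
by rewrite mulnC expgnA expg_order expg1n.
Qed.

Lemma expgs_mem A h n : h \in A -> h ^+ n \in A ^+ n.
Proof. by move=> hA; elim: n => [|n IH]; rewrite ?expg0 ?inE// !expgS mem_mulg. Qed.

Lemma expgsS A B n : A \subset B -> A ^+ n \subset B ^+ n.
Proof. by move=> AB; elim: n => [|n IH]; rewrite ?expg0// !expgS mulgSS. Qed.

Lemma one_in_expgs A : A != finset.set0 -> 1 \in A ^+ #|gT|.
Proof.
case/set0Pn => h hA; rewrite -(expg_cardT h).
exact: expgs_mem.
Qed.

Lemma expgsM_one A n k : 1 \in A ^+ n -> (0 < k)%N -> A ^+ n \subset A ^+ (n * k).
Proof.
move=> A1; case: k => // k _; elim: k => [|k IH]; first by rewrite muln1.
by rewrite mulnS expgnDr -{1}[A ^+ n]mul1g mulgSS// finset.sub1set.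
Qed.

(** Since [h^-1] is [h ^+ #|gT|.-1], each [g * h^-1] is a product of [#|gT|] elements of [A]. *)
Lemma sub_return_coset A h : h \in A -> A \subset return_group A :* h.
Proof.
move=> hA; apply/fintype.subsetP => g gA; rewrite mem_rcoset mem_gen//.
have D0 : (0 < #|gT|)%N by apply/card_gt0P; exists 1.
have -> : h^-1 = h ^+ #|gT|.-1.
  apply: (mulgI h); rewrite mulgV -expgS prednK// expg_cardT//.
by rewrite -{2}(prednK D0) expgS mem_mulg// expgs_mem.
Qed.

(** As 1 lies in [A ^+ #|gT|], this set is contained in its [k]-th power, which is
    [(A ^+ k) ^+ #|gT|]. *)
Lemma return_groupS A B k : A != finset.set0 -> (0 < k)%N -> A ^+ k \subset B ->
  return_group A \subset return_group B.
Proof.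
move=> A0 k0 AB; apply: genS; apply: fintype.subset_trans (expgsS #|gT| AB).
by rewrite -expgnA mulnC expgsM_one// one_in_expgs.
Qed.

Lemma return_group_pow A : A != finset.set0 ->
  exists2 n, (0 < n)%N & A ^+ n = return_group A.
Proof.
move=> A0; have A1 := one_in_expgs A0.
have [n En] := gen_expgs (A ^+ #|gT|).
rewrite (finset.setUidPr _) ?finset.sub1set// in En.
(* [n] may be 0; one more factor [A ^+ #|gT|] is absorbed by the group and makes the exponent
   positive. *)
exists (#|gT| * n.+1)%N.
  by rewrite muln_gt0 andbT; apply/card_gt0P; exists 1.
rewrite expgnA expgS -En /= ; apply/eqP; rewrite finset.eqEsubset; apply/andP; split.
  by rewrite mul_subG// subset_gen.
by rewrite -{1}[<<_>>]mul1g mulSg// finset.sub1set.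
Qed.

End return_group.

(** * Supports and uniform distributions on subgroups *)

Section support.
Context (R : realType) (gT : finGroupType).
Implicit Types x y : galg R gT.

Definition supp x : {set gT} := [set g | 0 < x g]%SET.

Lemma notin_supp x g : simplexS x -> g \notin supp x -> x g = 0.
Proof. by move=> [_ x0]; rewrite inE -leNgt => xg; apply/eqP; rewrite eq_le xg x0. Qed.

Lemma supp_neq0 x : simplexS x -> supp x != finset.set0.
Proof.
move=> Sx; apply/eqP => x0; have := oner_neq0 R; rewrite -Sx.1 big1 ?eqxx// => g _.
by apply: notin_supp => //; rewrite x0 inE.
Qed.

(** Nonnegative terms cannot cancel: a coefficient of [x * y] is positive as soon as one of its
    terms is. *)
Lemma suppM x y : simplexS x -> simplexS y ->
  supp (x * y) = (supp x * supp y)%g.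
Proof.
move=> [_ x0] [_ y0]; apply/finset.setP => g; rewrite inE galgME; apply/idP/idP => [|].
  rewrite lt_neqAle => /andP[]; rewrite eq_sym psumr_neq0; last first.
    by move=> h _; rewrite mulr_ge0.
  case/hasP => h _ /= h0 _; apply/mulsgP; exists h (h^-1 * g)%g; rewrite ?mulKVg//.
    by rewrite inE lt_neqAle x0 andbT; apply: contraTneq h0 => <-; rewrite mul0r ltxx.
  by rewrite inE lt_neqAle y0 andbT; apply: contraTneq h0 => <-; rewrite mulr0 ltxx.
case/mulsgP => h j; rewrite !inE => xh yj ->; rewrite (bigD1 h)//= mulKg.
by rewrite ltr_pwDl ?mulr_gt0// sumr_ge0// => i _; rewrite mulr_ge0.
Qed.

Lemma suppX x k : simplexS x -> supp (x ^+ k) = (supp x ^+ k)%g.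
Proof.
move=> Sx; elim: k => [|k IH]; last by rewrite exprS suppM ?IH ?expgS//; exact: simplexSX.
apply/finset.setP => g; rewrite expr0 expg0 !inE galg1E.
by case: eqP; rewrite ?ltr01 ?ltxx.
Qed.

Definition unif (K : {group gT}) : galg R gT := fun g => (g \in K)%:R / #|K|%:R.

Lemma unif_simplex (K : {group gT}) : simplexS (unif K).
Proof.
have K0 : #|K|%:R != 0 :> R by rewrite pnatr_eq0 -lt0n cardG_gt0.
split=> [|g]; last by rewrite divr_ge0.
by rewrite -mulr_suml -natr_sum -sum1_card -big_mkcond /= sum1_card divff.
Qed.

(** Every [j] in [supp y] has the same coset [K :* j = K :* h], so the sum averages equal values
    with total weight 1. *)
Lemma unifMl (K : {group gT}) y h g : simplexS y -> supp y \subset (K :* h)%g ->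
  (unif K * y) g = (g \in (K :* h)%g)%:R / #|K|%:R.
Proof.
move=> Sy /fintype.subsetP yK; rewrite [LHS]galg_mulE.
transitivity (\sum_j ((g \in (K :* h)%g)%:R / #|K|%:R) * y j); last first.
  by rewrite -mulr_sumr Sy.1 mulr1.
apply: eq_bigr => j _; have [jy|jy] := boolP (j \in supp y); last first.
  by rewrite (notin_supp Sy jy) !mulr0.
by rewrite /unif -mem_rcoset (rcoset_eqP (yK _ jy)).
Qed.

Lemma unifMr_id (K : {group gT}) y : simplexS y -> supp y \subset K ->
  y * unif K = unif K.
Proof.
move=> Sy /fintype.subsetP yK; apply/funext => g; rewrite galgME.
transitivity (\sum_j y j * unif K g); last first.
  by rewrite -mulr_suml Sy.1 mul1r.
apply: eq_bigr => j _; have [jy|jy] := boolP (j \in supp y); last first.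
  by rewrite (notin_supp Sy jy) !mul0r.
by rewrite /unif groupMl// groupV yK.
Qed.

Lemma unifMl_id (K : {group gT}) y : simplexS y -> supp y \subset K ->
  unif K * y = unif K.
Proof.
move=> Sy yK; apply/funext => g; rewrite (@unifMl _ _ 1%g)// ?rcoset1//.
Qed.

Lemma supp_unif (K : {group gT}) : supp (unif K) \subset K.
Proof. by apply/fintype.subsetP => g; rewrite inE /unif; case: (g \in K); rewrite // mul0r ltxx. Qed.

Lemma unif_idem (K : {group gT}) : unif K * unif K = unif K.
Proof. by apply: unifMr_id; [exact: unif_simplex|exact: supp_unif]. Qed.

(* The Doeblin minorisation [eps * unif K <= y] leaves a remainder of mass
   [1 - eps], and only this remainder acts on the range of [1 - unif K]. *)
Lemma unif_compl_contract (K : {group gT}) y : simplexS y -> supp y = K ->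
  exists2 eps : R, 0 < eps <= 1 &
    forall v, l1 ((1 - unif K) * (y * v)) <= (1 - eps) * l1 ((1 - unif K) * v).
Proof.
move=> Sy yK; set U := unif K.
have K0 : 0 < #|K|%:R :> R by rewrite ltr0n cardG_gt0.
have [d d0 dy] : exists2 d : R, 0 < d & forall g, g \in K -> d <= y g.
  (* The default 1 keeps the minimum positive and can only lower it. *)
  exists (\big[Order.min/1]_(g in K) y g).
    by elim/big_ind : _ => // [u w u0 w0|g]; [rewrite lt_min u0|rewrite -yK inE].
  by move=> g gK; rewrite (bigD1 g)//= ge_min lexx.
pose rho := y - (d * #|K|%:R) *: U.
have rho0 g : 0 <= rho g.
  rewrite /rho galgDE galgNE galgZE /U /unif; have [gK|gK] := boolP (g \in K).
    by rewrite mul1r mulfK ?gt_eqF// subr_ge0 dy.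
  by rewrite mul0r mulr0 subr0 Sy.2.
have l1rho : l1 rho = 1 - d * #|K|%:R.
  transitivity (\sum_g (y g - (d * #|K|%:R) * U g)).
    by apply: eq_bigr => g _; rewrite ger0_norm.
  by rewrite sumrB Sy.1 -mulr_sumr (unif_simplex K).1 mulr1.
exists (d * #|K|%:R).
  by rewrite mulr_gt0//= -subr_ge0 -l1rho l1_ge0.
(* [U] is idempotent and absorbs [y] on both sides, so both expressions equal [(y - U) * v]. *)
move=> v; rewrite -l1rho; have -> : (1 - U) * (y * v) = rho * ((1 - U) * v).
  rewrite !mulrA; congr (_ * v); rewrite /rho mulrBr mulr1 !mulrBl mul1r.
  rewrite -scalerAl unif_idem unifMr_id ?yK// unifMl_id ?yK//.
  by rewrite -/U opprB addrA subrK.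
exact: l1M.
Qed.

End support.

(** * An adapted seminorm and the growth of iterates in it *)

Lemma bernoulli_ineq (R : realType) (d : R) n : 0 <= d <= 1 ->
  1 - n%:R * d <= (1 - d) ^+ n.
Proof.
move=> /andP[d0 d1]; elim: n => [|n IH]; first by rewrite mul0r subr0.
have d'0 : 0 <= 1 - d by lra.
rewrite exprS; apply: le_trans (ler_wpM2l d'0 IH).
have : 0 <= n%:R * (d * d) by rewrite mulr_ge0 ?mulr_ge0.
rewrite -natr1; lra.
Qed.

Section orbit_norm.
Context (R : realType) (gT : finGroupType) (a : nat -> R) (ha : pmf a).
Context (e x : galg R gT) (r : R) (M : nat).
Implicit Types v w : galg R gT.

(** The usual renorming that turns a contraction of [x ^+ M] by [r ^+ M] into one of [x] by [r]; [e]
    will be the complement of a uniform distribution. *)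
Definition orbit_norm v : R := \sum_(n < M) r ^- n * l1 (e * (x ^+ n * v)).

Context (r0 : 0 < r).

Lemma orbit_normD v w : orbit_norm (v + w) <= orbit_norm v + orbit_norm w.
Proof.
rewrite -big_split; apply: ler_sum => n _ /=; rewrite -mulrDr.
by rewrite ler_wpM2l ?invr_ge0 ?exprn_ge0 ?(ltW r0)// !mulrDr l1D.
Qed.

Lemma orbit_normZ c v : orbit_norm (c *: v) = `|c| * orbit_norm v.
Proof.
rewrite /orbit_norm mulr_sumr; apply: eq_bigr => n _.
by rewrite -2!(scalerAr c) l1Z mulrCA.
Qed.

Lemma orbit_norm_bnd (F : nat -> galg R gT) : gbnd F ->
  bnd (fun k => orbit_norm (F k)).
Proof.
move=> bF; apply: bnd_sum => n; apply: bndM; first exact: bnd_cst.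
by apply: gbndMl; exact: gbndMl.
Qed.

Lemma orbit_norm_gexpect (F : nat -> galg R gT) : gbnd F ->
  orbit_norm (gexpect a F) <= expect a (fun k => orbit_norm (F k)).
Proof.
move=> bF; rewrite expect_sum//; last first.
  by move=> n; apply: bndM; [exact: bnd_cst|apply: gbndMl; exact: gbndMl].
apply: ler_sum => n _; have bxF : gbnd (fun k => x ^+ n * F k) by exact: gbndMl.
rewrite expectZ//; last exact: gbndMl.
rewrite ler_wpM2l ?invr_ge0 ?exprn_ge0 ?(ltW r0)//.
by rewrite !gexpectMl//; apply: l1_gexpect => //; exact: gbndMl.
Qed.

Context (M0 : (0 < M)%N).

Lemma l1_le_orbit_norm v : l1 (e * v) <= orbit_norm v.
Proof.
rewrite /orbit_norm; case: M M0 => // m _; rewrite big_ord_recl expr0 invr1 !mul1r.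
rewrite lerDl; apply: sumr_ge0 => n _.
by rewrite mulr_ge0 ?l1_ge0// invr_ge0 exprn_ge0// ltW.
Qed.

Context (xM : forall v, l1 (e * (x ^+ M * v)) <= r ^+ M * l1 (e * v)).

Lemma orbit_norm_contract v : orbit_norm (x * v) <= r * orbit_norm v.
Proof.
rewrite /orbit_norm; case: M M0 xM => // m _ xm.
(* Multiplying by [x] shifts the sum by one place; its last term, in [x ^+ m.+1], returns to the
   first through [xm]. *)
rewrite big_ord_recr [in leRHS]big_ord_recl /= expr0 invr1 !mul1r mulrDr.
rewrite addrC; apply: lerD.
  rewrite [x ^+ m * _]mulrA -exprSr ler_pdivrMl ?exprn_gt0// [r ^+ m * _]mulrA -exprSr.
  exact: xm.
rewrite mulr_sumr; apply: ler_sum => n _; rewrite [x ^+ n * _]mulrA -exprSr /bump /= add1n.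
rewrite [r * _]mulrA [r ^+ n.+1]exprS invfM [r * (_ * _)]mulrA divff ?mul1r//.
by rewrite gt_eqF.
Qed.

End orbit_norm.

Section seminorm_iter.
Context (R : realType) (gT : finGroupType) (a : nat -> R) (ha : pmf a).
Context (N : galg R gT -> R).
Context (ND : forall v w, N (v + w) <= N v + N w).
Context (NZ : forall c v, N (c *: v) = `|c| * N v).
Context (Nbnd : forall F, gbnd F -> bnd (fun k => N (F k))).
Context (NE : forall F, gbnd F -> N (gexpect a F) <= expect a (fun k => N (F k))).
Implicit Types (x v : galg R gT) (s t : R).

(** Telescoping: the difference at [k.+1] is [x] times the one at [k] plus [s ^+ k] times the one at
    1. The bounds obey the same recursion, with [t] in place of [x]. *)
Lemma seminorm_exp x s t k : 0 <= s <= t ->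
  (forall v, N (x * v - s *: v) <= (t - s) * N v) ->
  forall v, N (x ^+ k * v - s ^+ k *: v) <= (t ^+ k - s ^+ k) * N v.
Proof.
move=> /andP[s0 st] xs v.
have t0 : 0 <= t by exact: le_trans st.
have Nx w : N (x * w) <= t * N w.
  rewrite -(subrK (s *: w) (x * w)); apply: le_trans (ND _ _) _.
  by rewrite NZ ger0_norm//; have := xs w; lra.
elim: k => [|k IH]; first by rewrite !expr0 mul1r scale1r !subrr -(scale0r v) NZ normr0 !mul0r.
have -> : x ^+ k.+1 * v - s ^+ k.+1 *: v =
    x * (x ^+ k * v - s ^+ k *: v) + s ^+ k *: (x * v - s *: v).
  rewrite mulrBr scalerBr scalerA -exprSr mulrA -exprS scalerAr.
  by rewrite addrA subrK.
apply: le_trans (ND _ _) _; rewrite NZ ger0_norm ?exprn_ge0//.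
apply: (@le_trans _ _ (t * ((t ^+ k - s ^+ k) * N v) + s ^+ k * ((t - s) * N v))).
  by apply: lerD; [exact: le_trans (Nx _) (ler_wpM2l t0 IH)|rewrite ler_wpM2l ?exprn_ge0].
by rewrite [t ^+ k.+1]exprS [s ^+ k.+1]exprS; lra.
Qed.

(* [genfun a] applied to the reals [0 <= r < 1] majorises [pmap a] applied to
   [x]: the coefficients of the iterated power series are nonnegative. *)
Lemma seminorm_iter x r i : simplexS x -> 0 <= r <= 1 ->
  (forall v, N (x * v) <= r * N v) ->
  forall v, N ((piter a i x : galg R gT) * v - iter i (genfun a) 0 *: v)
    <= (iter i (genfun a) r - iter i (genfun a) 0) * N v.
Proof.
move=> Sx r01 xr; elim: i => [|i IH] v; first by rewrite /= scale0r !subr0.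
pose y : galg R gT := piter a i x.
have Sy : simplexS y by exact: piter_simplex.
rewrite [piter a i.+1 x](_ : _ = gexpect a (fun k => y ^+ k)); last first.
  by rewrite -pmapE.
rewrite [iter i.+1 _ r]/= [iter i.+1 _ 0]/=.
set s := iter i _ 0 in IH *; set t := iter i _ r in IH *.
have /andP[r0 r1] := r01.
have s01 : 0 <= s <= 1 by apply: genfun_iter_itv => //; lra.
have t01 : 0 <= t <= 1 by exact: genfun_iter_itv.
have st : 0 <= s <= t by rewrite (andP s01).1; exact: genfun_iter_le.
have by_ := gbnd_exp Sy; have bs := bnd_exp s01; have bt := bnd_exp t01.
have bsv : gbnd (fun k => s ^+ k *: v) by exact: gbndZ.
have byv : gbnd (fun k => y ^+ k * v) by exact: gbndMr.
have bF : gbnd (fun k => y ^+ k * v - s ^+ k *: v).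
  apply: gbndD => //; under [X in gbnd X]eq_fun do rewrite -scaleNr.
  by apply: gbndZ; exact: bndN.
rewrite gexpectMr// /genfun -gexpectZ// -gexpectB//; apply: le_trans (NE bF) _.
rewrite -expectB// mulrC -expectZ//; last by apply: bndD => //; exact: bndN.
apply: ler_expect => // [||k].
- exact: Nbnd.
- apply: bndM; first exact: bnd_cst.
  by apply: bndD => //; exact: bndN.
- by rewrite mulrC; exact: seminorm_exp.
Qed.

End seminorm_iter.

(** * Convergence of the part complementary to the uniform distribution *)

Lemma piter_compl_cvg (R : realType) (gT : finGroupType) (a : nat -> R)
    (x : galg R gT) : pmf a -> a 1%N < 1 -> simplexS x ->
  exists q : R, forall g,
    ((1 - unif R (return_group (supp x))) * piter a i x : galg R gT) g @[i --> \oo]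
      --> q * (1 - unif R (return_group (supp x)) : galg R gT) g.
Proof.
move=> ha a1 Sx; set e : galg R gT := 1 - _.
have [M M0 EM] := return_group_pow (supp_neq0 Sx).
have sM : supp (x ^+ M) = return_group (supp x) by rewrite suppX.
have [eps /andP[eps0 eps1] xM] := unif_compl_contract (simplexSX M Sx) sM.
rewrite -/e in xM.
(* Bernoulli gives [1 - eps <= 1 - M * d <= r ^+ M]; the denominator [M.+1] keeps [r] positive even
   if [eps = 1] and [M = 1]. *)
pose d := eps / M.+1%:R; pose r := 1 - d.
have d0 : 0 < d by rewrite divr_gt0.
have d1 : d < 1.
  by rewrite ltr_pdivrMr// mul1r (le_lt_trans eps1)// ltr1n.
have r0 : 0 < r by rewrite subr_gt0.
have xM' v : l1 (e * (x ^+ M * v)) <= r ^+ M * l1 (e * v).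
  apply: (le_trans (xM v)); rewrite ler_wpM2r ?l1_ge0//.
  apply: le_trans (bernoulli_ineq _ _); last by rewrite !ltW.
  rewrite lerB// /d mulrCA ler_piMr ?(ltW eps0)// ler_pdivrMr// mul1r ler_nat.
  exact: leqnSn.
pose N := orbit_norm e x r M.
have key := @seminorm_iter _ _ _ ha N (orbit_normD e x M r0) (orbit_normZ e x r M)
  (@orbit_norm_bnd _ _ e x r M) (@orbit_norm_gexpect _ _ _ ha e x r M r0) x r _ Sx.
have [q _ [sq q1]] := genfun_iter0_cvg ha; exists q => g.
have r01 : 0 <= r < 1 by rewrite ltW//= gtrBl.
have rN v : N (x * v) <= r * N v by exact: orbit_norm_contract.
have coal := genfun_iter_coalesce ha a1 r01.
pose s i := iter i (genfun a) 0.
(* Taking [v = 1] in [key] recovers the iterate itself, and the [n = 0] term of [N] controls its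
   coordinates. *)
have bound i : `|(e * piter a i x : galg R gT) g - s i * e g|
    <= (iter i (genfun a) r - s i) * N 1.
  have r01' : 0 <= r <= 1 by case/andP: r01 => -> /ltW.
  apply: le_trans (key i r01' rN 1); rewrite mulr1.
  apply: le_trans (l1_le_orbit_norm _ _ r0 M0 _).
  apply: le_trans (ler_norm_l1 _ g).
  by rewrite [e * (_ - _)]mulrBr -scalerAr mulr1 galgDE galgNE galgZE.
have -> : (fun i => (e * piter a i x : galg R gT) g) =
    (fun i => ((e * piter a i x : galg R gT) g - s i * e g) + s i * e g).
  by apply/funext => i; rewrite subrK.
rewrite -[X in _ --> X]add0r; apply: cvgD; last first.
  by apply: cvgM => //; exact: cvg_cst.
apply/cvgr0Pnorm_lt => eps' eps'0.
have /cvgr0Pnorm_lt/(_ _ eps'0) : (iter i (genfun a) r - s i) * N 1 @[i --> \oo] --> (0 : R).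
  by rewrite -(mul0r (N 1)); apply: cvgM => //; exact: cvg_cst.
apply: filterS => i; apply: le_lt_trans.
by apply: le_trans (bound i) _; exact: ler_norm.
Qed.

(** * Eventually periodic sequences and chains of subgroups *)

(** Once the mean [m] over a period is subtracted, the partial sums are eventually periodic too,
    hence bounded, and vanish after division by [n.+1]. *)
Lemma periodic_mean_cvg (R : realType) (w : nat -> R) (T n0 : nat) : (0 < T)%N ->
  (forall n, (n0 <= n)%N -> w (n + T)%N = w n) -> cvgn (arithmetic_mean w).
Proof.
move=> T0 wT; pose m := T%:R^-1 * \sum_(i < T) w (n0 + i)%N.
pose b n := \sum_(0 <= i < n) (w i - m).
have bS n : b n.+1 = b n + (w n - m) by rewrite /b big_nat_recr.
have bT n : b (n0 + n + T)%N = b (n0 + n)%N.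
  elim: n => [|n IH]; last by rewrite addnS addSn !bS IH wT ?leq_addr.
  rewrite addn0 /b (@big_cat_nat _ _ _ n0) ?leq_addr//= -[RHS]addr0; congr (_ + _).
  rewrite -{1}[n0]add0n big_addn addnC addnK big_mkord sumrB sumr_const card_ord.
  rewrite /m -[X in _ - X]mulr_natl mulVKf ?pnatr_eq0 -?lt0n//.
  by under eq_bigr do rewrite addnC; rewrite subrr.
(* The first [n0 + T] partial sums bound all others, by descending [T] steps at a time. *)
pose C := \sum_(j < n0 + T) `|b j|.
have bC n : `|b n| <= C.
  elim/ltn_ind: n => n IH; have [nT|nT] := ltnP n (n0 + T).
    by rewrite /C (bigD1 (Ordinal nT))//= lerDl sumr_ge0.
  have nT' : (T <= n)%N by rewrite (leq_trans _ nT)// leq_addl.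
  have -> : b n = b (n - T)%N.
    have nT0 : (n0 <= n - T)%N by rewrite leq_subRL// addnC.
    by have := bT (n - T - n0)%N; rewrite (subnKC nT0) (subnK nT').
  by apply: IH; rewrite ltn_subrL T0 (leq_trans T0).
apply/cvg_ex; exists m.
have -> : arithmetic_mean w = (fun n => n.+1%:R^-1 * b n.+1 + m).
  apply/funext => n; rewrite /arithmetic_mean /series/= /b sumrB mulrBr.
  by rewrite sumr_const_nat subn0 -[X in _ - _ * X]mulr_natl mulKf ?pnatr_eq0// subrK.
rewrite -[X in _ --> X]add0r; apply: cvgD; last exact: cvg_cst.
have hC : C * harmonic n @[n --> \oo] --> (0 : R).
  by rewrite -(mulr0 C); apply: cvgM; [exact: cvg_cst|exact: cvg_harmonic].
have hNC : - (C * harmonic n) @[n --> \oo] --> (0 : R) by rewrite -oppr0; exact: cvgN.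
apply: squeeze_cvgr hNC hC; near=> n.
rewrite -ler_norml normrM ger0_norm ?invr_ge0// mulrC.
by rewrite ler_wpM2r ?invr_ge0.
Unshelve. all: by end_near. Qed.

(** Pigeonhole: two of the first [#|T|.+1] iterates coincide. *)
Lemma iter_fin_periodic (T : finType) (f : T -> T) (z : T) :
  exists2 p, (0 < p)%N &
    exists n0, forall n, (n0 <= n)%N -> iter (n + p) f z = iter n f z.
Proof.
have : ~~ injectiveb (fun i : 'I_(#|T|.+1) => iter i f z).
  by apply/negP => /injectiveP/leq_card; rewrite card_ord ltnn.
case/injectivePn => i [j ij E].
wlog lij : i j ij E / (i < j)%N.
  move=> W; case: (ltngtP i j) => [|ji|/val_inj ij']; first exact: W.
    by apply: (W j i) => //; rewrite eq_sym.
  by rewrite ij' eqxx in ij.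
exists (j - i)%N; first by rewrite subn_gt0.
exists i => n leq_in; rewrite -(subnK leq_in) -addnA subnKC ?(ltnW lij)//.
by rewrite !iterD E.
Qed.

(** A term of maximal cardinality equals every later one, since these contain it. *)
Lemma group_chain_stable (gT : finGroupType) (K : nat -> {group gT}) :
  (forall i, K i \subset K i.+1) -> exists J, forall i, K (i + J)%N = K J.
Proof.
move=> KS; pose P := [pred c | `[< exists i, #|K i| = c >]].
have exP : exists c, P c by exists #|K 0%N|; apply/asboolP; exists 0%N.
have leP c : P c -> (c <= #|gT|)%N by move=> /asboolP[i <-]; exact: max_card.
case: (ex_maxnP exP leP) => _ /asboolP[J <-] max; exists J => i.
have KJ : K J \subset K (i + J)%N.
  by elim: i => //= i IH; apply: fintype.subset_trans IH (KS _).
apply/val_inj/eqP; rewrite /= eq_sym eqEcard KJ /=.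
by apply: max; apply/asboolP; exists (i + J)%N.
Qed.

(** * Growth of the supports and convergence of the averages *)

(** Otherwise all the mass sits at 0. The exponent found here drives the growth of the supports. *)
Lemma pmf_support (R : realType) (a : nat -> R) : pmf a -> a 0%N < 1 ->
  exists2 k, (0 < k)%N & 0 < a k.
Proof.
move=> ha a0; apply: contrapT => noK.
suff : a 0%N = 1 by move=> E; rewrite E ltxx in a0.
rewrite -(expect_cst ha 1) -(expect_delta a 0) /expect; congr (limn (series _)).
apply/funext => -[|k] //; rewrite /= mulr0 mulr1; apply/eqP.
rewrite eq_le ha.1 /= leNgt; apply/negP => ak; apply: noK.
by exists k.+1.
Qed.

Lemma supp_pmap (R : realType) (gT : finGroupType) (a : nat -> R) (x : galg R gT) k :
  pmf a -> simplexS x -> 0 < a k -> (supp x ^+ k)%g \subset supp (Defs.pmap a x).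
Proof.
move=> ha Sx ak; rewrite -suppX//; apply/fintype.subsetP => g; rewrite !inE => xg.
rewrite pmapE; apply: (lt_le_trans (mulr_gt0 ak xg)).
apply: (@expect_ge_term _ _ ha (fun k => (x ^+ k) g)).
  by apply: gbnd_coord; exact: gbnd_exp.
by move=> j; have /andP[] := simplexS_le1 g (simplexSX j Sx).
Qed.

Theorem theorem5 (R : realType) (gT : finGroupType) (a : nat -> R)
  (ha : forall k, 0 <= a k /\ a k < 1)
  (hsum : series a @ \oo --> (1 : R)) :
  forall x : gT -> R, simplexS x ->
    exists L : gT -> R, forall g : gT,
      (fun n : nat => n%:R^-1 * \sum_(1 <= i < n.+1) piter a i x g) @ \oo
        --> L g.
Proof.
move=> x Sx; have pa : pmf a by split=> // k; have [] := ha k.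
pose y i : galg R gT := piter a i x.
have Sy i : simplexS (y i) by exact: piter_simplex.
have [k k0 ak] := pmf_support pa (ha 0%N).2.
have yS i : (supp (y i) ^+ k)%g \subset supp (y i.+1) by exact: supp_pmap.
pose K i := return_group (supp (y i)).
have [J KJ] : exists J, forall i, K (i + J)%N = K J.
  by apply: group_chain_stable => i; apply: return_groupS (yS i) => //; exact: supp_neq0.
have /set0Pn[h0 h0x] := supp_neq0 (Sy 0%N).
(* Following one point of the support by [k]-th powers gives coset representatives that iterate a
   self-map of a finite set. *)
pose h i := iter i (fun h : gT => h ^+ k)%g h0.
have hy i : h i \in supp (y i).
  elim: i => // i IH; apply: (fintype.subsetP (yS i)); exact: expgs_mem.
have [p p0 [n0 hp]] := iter_fin_periodic (fun h : gT => h ^+ k)%g h0.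
(* The orbit is restarted at [y J], whose subgroup [K J] serves all later iterates. *)
have [q qc] := piter_compl_cvg pa (ha 1%N).2 (Sy J).
suff Lg g : cvgn (fun n : nat => n%:R^-1 * \sum_(1 <= i < n.+1) piter a i x g).
  by exists (fun g => limn (fun n : nat => n%:R^-1 * \sum_(1 <= i < n.+1) piter a i x g)).
pose W i : R := (g \in (K J :* h i)%g)%:R / #|K J|%:R.
(* From [J] on, [W i] is the coefficient at [g] of [unif R (K J) * y i], so this difference is that
   of the complementary part. *)
have Ec : y i g - W i @[i --> \oo] --> q * (1 - unif R (K J) : galg R gT) g.
  rewrite -(cvg_shiftn J); apply: cvg_trans (qc g); apply: near_eq_cvg.
  near=> i; rewrite mulrBl mul1r galgDE galgNE -/(piter a i (y J)).
  have -> : piter a i (y J) = y (i + J)%N by rewrite /y /piter iterD.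
  congr (_ - _); apply: unifMl => //.
  by rewrite -/(K J) -(KJ i); exact: sub_return_coset.
have Wc : cvgn (arithmetic_mean (fun i => W i.+1)).
  apply: (@periodic_mean_cvg _ _ p n0) => // n n0n.
  by rewrite /W /h -addSn hp// leqW.
have Ec' : y i.+1 g - W i.+1 @[i --> \oo] --> q * (1 - unif R (K J) : galg R gT) g.
  by rewrite -(cvg_shiftn 1) in Ec; under eq_fun do rewrite -addn1.
have /cesaro Ec'' := Ec'.
apply/cvg_ex; exists (q * (1 - unif R (K J) : galg R gT) g +
  limn (arithmetic_mean (fun i => W i.+1))).
(* [arithmetic_mean] divides the first [n.+1] terms by [n.+1]; shifting [n] by one aligns it with
   the average over the indices 1 to [n]. *)
rewrite -(cvg_shiftn 1); apply: cvg_trans (cvgD Ec'' Wc); apply: near_eq_cvg.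
near=> n; rewrite fctE /arithmetic_mean /series/= -mulrDr -big_split/= addn1.
rewrite big_add1 /=; congr (_ * _); apply: eq_bigr => i _.
by rewrite subrK.
Unshelve. all: by end_near. Qed.
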